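(* Let $p\geq 11$ be a prime with $p\not\equiv \pm1 \pmod 8$. Identify the elements of $\mathrm{GF}(p)$ with the integers $\{0,1,\ldots,p-1\}$, let $S$ be the set of nonzero squares and $N$ the set of nonsquares of $\mathrm{GF}(p)$ (viewed as sets of integers). Construct a vertex-labelled rooted tree $T$ with levels $0,1,2$ as follows: level $0$ is a single vertex labelled $0$; level $1$ consists of children of this root, labelled by all elements of $N$ together with all elements $s\in S$ with $s>p/2$; level $2$ consists of vertices labelled by the elements $s\in S$ with $s<p/2$, where the vertex labelled $s$ is made a child of the level-$1$ vertex labelled $2s$ (note $2s\in N$). Then $T$ is a tree, the map sending each vertex to its label is a near $\alpha$-valuation of $T$, and $T$ admits no $\alpha$-valuation. Moreover, if $p\equiv 5\pmod 8$, then $T$ is a rooted tree whose root has $3(p-1)/4$ children, of which $(p-1)/4$ have exactly one child each (and the rest have none).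
   Context: A $\beta$-valuation (graceful labelling) of a graph $G$ with $n$ edges is an injective map $b:V(G)\to\{0,1,\ldots,n\}$ such that the multiset $\{|b(u)-b(v)| : \{u,v\}\in E(G)\}$ equals $\{1,2,\ldots,n\}$. An $\alpha$-valuation is a $\beta$-valuation $b$ for which there is an integer $x$ with $0\le x\le n$ such that every edge $\{u,v\}$ satisfies $b(u)\le x<b(v)$ or $b(v)\le x<b(u)$. A near $\alpha$-valuation is a $\beta$-valuation $b$ for which there is a partition $V(G)=V_{small}\cup V_{large}$ such that each $v\in V_{small}$ has $b(v)<b(u)$ for every neighbour $u$ of $v$, and each $v\in V_{large}$ has $b(v)>b(u)$ for every neighbour $u$ of $v$. *)

(* Defs.v *)
From HB Require Import structures.
From mathcomp Require Import all_boot all_order all_algebra.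

Set Implicit Arguments.
Unset Strict Implicit.
Unset Printing Implicit Defensive.

Import GRing.Theory.

(* Finite simple graphs *)

Record sgraph := SGraph {
  vertex :> finType;
  adj : rel vertex;
  adj_sym : symmetric adj;
  adj_irr : irreflexive adj }.

Arguments adj {s} _ _.

Definition edges (G : sgraph) : {set {set G}} :=
  [set [set uv.1; uv.2] | uv : G * G & adj uv.1 uv.2].

Definition is_tree (G : sgraph) : Prop :=
  [/\ 0 < #|G|,
      forall u v : G, connect adj u v
    & forall c : seq G, 2 < size c -> ~ ucycle adj c].

(* In a tree rooted at r, w is a child of v when w is a neighbour of v and
   every path from r to w goes through v, i.e., r and w are not connected by
   edges avoiding v (when v = r no edge leaves r, so this holds trivially). *)
Definition children (G : sgraph) (r v : G) : {set G} :=
  [set w | adj v w &&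
     ~~ connect [rel x y : G | [&& adj x y, x != v & y != v]] r w].

(* Valuations *)

(* |b(u) - b(v)| for the edge e = {u, v}; see edge_diffE. *)
Definition edge_diff (G : sgraph) (b : G -> nat) (e : {set G}) : nat :=
  \max_(u in e) \max_(v in e) `|b u - b v|%N.

Lemma edge_diffE (G : sgraph) (b : G -> nat) (u v : G) :
  edge_diff b [set u; v] = `|b u - b v|%N.
Proof.
apply/eqP; rewrite eqn_leq; apply/andP; split.
  apply/bigmax_leqP => x /set2P xuv; apply/bigmax_leqP => y /set2P yuv.
  by case: xuv => ->; case: yuv => ->; rewrite ?distnn // distnC.
have Hu : u \in [set u; v] by rewrite set21.
have Hv : v \in [set u; v] by rewrite set22.
apply: leq_trans (leq_bigmax_cond _ Hu).
exact: (leq_bigmax_cond (F := fun y => `|b u - b y|%N) _ Hv).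
Qed.

Definition beta_valuation (G : sgraph) (b : G -> nat) : Prop :=
  [/\ injective b,
      forall v : G, b v <= #|edges G|
    & perm_eq [seq edge_diff b e | e in edges G] (iota 1 #|edges G|)].

Definition alpha_valuation (G : sgraph) (b : G -> nat) : Prop :=
  beta_valuation b /\
  exists2 x : nat, x <= #|edges G|
    & forall u v : G, adj u v -> (b u <= x < b v) \/ (b v <= x < b u).

Definition near_alpha_valuation (G : sgraph) (b : G -> nat) : Prop :=
  beta_valuation b /\
  exists Vsmall Vlarge : {set G},
    [/\ Vsmall :|: Vlarge = [set: G],
        [disjoint Vsmall & Vlarge],
        forall v u : G, v \in Vsmall -> adj v u -> b v < b u
      & forall v u : G, v \in Vlarge -> adj v u -> b u < b v].

(* The tree T; GF(p) is identified with {0, ..., p - 1} by the coercion from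
   'F_p, a type of ordinals, to nat. *)

Definition nz_squares (p : nat) : {set 'F_p} :=
  [set x : 'F_p | (x != 0%R) && [exists y : 'F_p, x == (y ^+ 2)%R]].

Definition nonsquares (p : nat) : {set 'F_p} :=
  [set x : 'F_p | ~~ [exists y : 'F_p, x == (y ^+ 2)%R]].

Definition level_labels (p : nat) (l : 'I_3) : {set 'F_p} :=
  match val l with
  | 0 => [set 0%R]
  | 1 => nonsquares p :|: [set s in nz_squares p | p < 2 * (s : nat)]
  | _ => [set s in nz_squares p | 2 * (s : nat) < p]
  end.

Definition T_vertex (p : nat) : finType :=
  {v : 'I_3 * 'F_p | v.2 \in level_labels p v.1}.

Definition T_level (p : nat) (v : T_vertex p) : nat := (val v).1.

Definition T_label (p : nat) (v : T_vertex p) : nat := (val v).2.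

Definition T_parent (p : nat) (u v : T_vertex p) : bool :=
  ((T_level u == 0) && (T_level v == 1))
  || [&& T_level u == 1, T_level v == 2 & T_label u == 2 * T_label v].

Definition T_adj (p : nat) (u v : T_vertex p) : bool := T_parent u v || T_parent v u.

Lemma T_adj_sym (p : nat) : symmetric (@T_adj p).
Proof. by move=> u v; rewrite /T_adj orbC. Qed.

Lemma T_adj_irr (p : nat) : irreflexive (@T_adj p).
Proof. by move=> v; rewrite /T_adj /T_parent; case: (T_level v) => [|[|]]. Qed.

Definition T (p : nat) : sgraph := SGraph (@T_adj_sym p) (@T_adj_irr p).

Lemma T_root_subproof (p : nat) : (0%R : 'F_p) \in level_labels p ord0.
Proof. by rewrite inE. Qed.

Definition T_root (p : nat) : T p := exist _ (ord0, 0%R) (T_root_subproof p).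

(* Main.v *)
Require Import Defs.
From HB Require Import structures.
From mathcomp Require Import all_boot all_order all_algebra.
From mathcomp Require Import finfield zify.

(* By Gauss's lemma 2 is a nonsquare when p = 3 or 5 mod 8, so doubling maps
   squares to nonsquares and the labels are exactly 0, ..., p - 1; the edge from
   any non-root vertex to its parent has the label of that vertex as difference.

   In an alpha-valuation (up to b -> n - b) the even levels A get labels at most
   x and level 1 gets labels above x.  Distinct edges joining A without the root
   to level 1 are disjoint.  Since differences n, n - 1 live on the labels
   0, 1 | n - 1, n and differences 2, 1 on x - 1, x | x + 1, x + 2, the root
   must be labelled in {0, 1} and in {x - 1, x}, so x <= 2; but A has at least
   four vertices, as there are three squares below p / 2.

   When p = 1 mod 4 the squares are closed under negation, so half of them are
   below p / 2. *)

Import GRing.Theory.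

(** * Elements of GF(p) as natural numbers *)

Lemma Fp_lt (p : nat) (x : 'F_p) : prime p -> x < p.
Proof. by move=> p_pr; rewrite -[X in _ < X](Fp_cast p_pr) ltn_ord. Qed.

Lemma Fp_natK (p : nat) (x : 'F_p) : (nat_of_ord x)%:R%R = x.
Proof. exact: natr_Zp. Qed.

Lemma Fp_double_nat (p : nat) (s : 'F_p) :
  prime p -> 2 * (s : nat) < p -> (s *+ 2)%R = 2 * (s : nat) :> nat.
Proof.
move=> p_pr lt2s; have := val_Fp_nat p_pr (2 * s).
by rewrite natrM Fp_natK mulr_natl modn_small.
Qed.

Lemma Fp_opp_nat (p : nat) (x : 'F_p) :
  prime p -> x != 0%R -> (- x)%R = p - (x : nat) :> nat.
Proof.
move=> p_pr nz_x; have x_lt := Fp_lt p x p_pr.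
have x_gt0 : 0 < x by rewrite lt0n; apply: contra nz_x => /eqP x0; apply/eqP/val_inj.
have := val_Fp_nat p_pr (p - x).
by rewrite natrB ?(ltnW x_lt) // pchar_Fp_0 // Fp_natK sub0r modn_small //; lia.
Qed.

(** * The quadratic character of 2 *)

Lemma fact_even_odd (n : nat) :
  n`! = (\prod_(i < n./2) (2 * i.+1)) * \prod_(i < uphalf n) (2 * i).+1.
Proof.
elim: n => [|n IHn]; first by rewrite !big_ord0.
rewrite factS IHn uphalf_half /= uphalf_half.
have := odd_double_half n; case: (odd n) => /= def_n.
  rewrite [in RHS]big_ord_recr /=.
  have -> : n.+1 = 2 * n./2.+1 by lia.
  by rewrite mulnCA !mulnA.
rewrite [in RHS]big_ord_recr /=.
have -> : n.+1 = (2 * n./2).+1 by lia.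
by rewrite mulnC mulnA.
Qed.

(* Gauss's lemma for 2: among 2, 4, ..., p - 1 the residues above p / 2 are the
   negatives of the odd numbers up to p / 2. *)
Lemma Fp_exp2_half (p : nat) :
  prime p -> odd p -> (2 ^+ p./2 = (-1) ^+ uphalf p./2 :> 'F_p)%R.
Proof.
move=> p_pr p_odd; set h := p./2.
have def_p : p = (2 * h).+1 by have := odd_double_half p; rewrite p_odd /h; lia.
have fact_nz : (h`!%:R != 0 :> 'F_p)%R.
  have := unitFpE p_pr h`!; rewrite unitfE => ->.
  rewrite fact_prod big_nat; elim/big_ind: _ => [|x y|i i_le]; rewrite ?coprimen1 //.
    by rewrite coprimeMr => -> ->.
  by rewrite prime_coprime // gtnNdvd //; lia.
apply: (mulIf fact_nz).
have -> : (2 ^+ h * h`!%:R = (\prod_(i < h) (2 * i.+1))%:R :> 'F_p)%R.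
  rewrite big_split /= prod_nat_const card_ord natrM natrX.
  by congr (_ * _%:R)%R; rewrite fact_prod big_add1 /= big_mkord.
have def_h : h = h./2 + uphalf h by rewrite uphalf_half; have := odd_double_half h; lia.
rewrite [in LHS]def_h big_split_ord /= [in RHS]fact_even_odd !natrM mulrCA.
(* The even numbers up to [h] cancel. Read backwards, the remaining even factors are
   [2 * (h - i) = p - (2 * i).+1], each the negative of an odd factor of [h]!. *)
congr (_ * _)%R; rewrite [in LHS](reindex_inj rev_ord_inj) /= !natr_prod.
rewrite -[X in (_ ^+ X)%R](card_ord (uphalf h)) -prodr_const -big_split /=.
apply: eq_bigr => i _; apply/eqP; rewrite mulN1r -addr_eq0 -natrD -(pchar_Fp_0 p_pr).
by apply/eqP; congr (_%:R)%R; have := ltn_ord i; rewrite /=; lia.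
Qed.

(** A square root [y] of 2 would give [2 ^+ p./2 = y ^+ p.-1 = 1] by Fermat. Gauss's lemma gives -1
    instead, because [uphalf p./2] is odd when [p] is 3 or 5 modulo 8. *)
Lemma Fp_two_nonsquare (p : nat) (y : 'F_p) :
  prime p -> p != 1 %[mod 8] -> p != 7 %[mod 8] -> 2 < p -> (y ^+ 2 != 2)%R.
Proof.
move=> p_pr p_n1 p_n7 p_gt2.
have p_odd : odd p by have /even_prime[p2|] := p_pr; first by rewrite p2 in p_gt2.
apply/eqP => y2; have := Fp_exp2_half p p_pr p_odd.
have nz2 : (2 != 0 :> 'F_p)%R.
  have := unitFpE p_pr 2; rewrite unitfE => ->.
  by rewrite prime_coprime // gtnNdvd.
have nz_y : (y != 0)%R by apply: contraNneq nz2 => y0; rewrite -y2 y0 expr0n.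
have yp1 : (y ^+ p.-1 = 1)%R.
  apply: (mulfI nz_y); rewrite mulr1 -exprS prednK ?prime_gt0 //.
  by rewrite -{2}(expf_card y) card_Fp.
rewrite -y2 -exprM mul2n; have := odd_double_half p; rewrite p_odd.
have -> : p./2.*2 = p.-1 by have := odd_double_half p; rewrite p_odd; lia.
rewrite yp1 -signr_odd.
have -> : odd (uphalf p./2).
  move: p_n1 p_n7; rewrite (divn_eq p 8) !modnMDl.
  have : p %% 8 < 8 by rewrite ltn_mod.
  move: p_odd; rewrite {1}(divn_eq p 8) .
  by lia.
move=> _ /eqP; rewrite expr1 -subr_eq0 opprK => /eqP two0; move: nz2.
by rewrite mulr2n two0 eqxx.
Qed.

(** * Counting squares, and squares below p / 2 *)

(** As [p] is odd and [- x] is represented by [p - x], exactly one of [x] and [- x] lies below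
    [p / 2] for each nonzero [x]. *)
Lemma card_opp_closed (p : nat) (A : {set 'F_p}) :
  prime p -> odd p -> 0%R \notin A -> (forall x, x \in A -> (- x)%R \in A) ->
  #|A| = 2 * #|[set x in A | 2 * (x : nat) < p]|.
Proof.
move=> p_pr p_odd A0 oppA; set L := [set x in A | _].
have AE : A = L :|: [set - x | x in L]%R.
  apply/setP => x; rewrite in_setU; apply/idP/orP => [xA|]; last first.
    case=> [|/imsetP[y yL ->]]; first by rewrite inE => /andP[].
    by apply: oppA; move: yL; rewrite inE => /andP[].
  have nz_x : x != 0%R by apply: contraNneq A0 => <-.
  case: (ltnP (2 * x) p) => [lt2x | le2x]; [left | right].
    by rewrite inE xA.
  apply/imsetP; exists (- x)%R; rewrite ?opprK // inE oppA // Fp_opp_nat //.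
  by have := Fp_lt p x p_pr; lia.
rewrite {1}AE cardsU card_imset ?addnn ?mul2n; last exact: oppr_inj.
rewrite (_ : _ :&: _ = set0) ?cards0 ?subn0 //; apply/setP => x; rewrite in_set0 inE.
apply/negP => /andP[xL /imsetP[y yL def_x]]; move: xL yL; rewrite !inE.
move=> /andP[_ lt2x] /andP[yA lt2y].
have nz_y : y != 0%R by apply: contraNneq A0 => <-.
by move: lt2x; rewrite def_x Fp_opp_nat //; have := Fp_lt p y p_pr; lia.
Qed.

Lemma card_nonzero_Fp (p : nat) : prime p -> #|[set x : 'F_p | x != 0%R]| = p.-1.
Proof.
move=> p_pr; have := cardsC1 (0%R : 'F_p); rewrite card_Fp // => <-.
by apply: eq_card => x; rewrite !inE.
Qed.

(** Squaring identifies exactly [y] and [- y], so it maps the nonzero elements below [p / 2]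
    bijectively onto the nonzero squares. *)
Lemma card_nz_squares (p : nat) : prime p -> odd p -> p.-1 = 2 * #|nz_squares p|.
Proof.
move=> p_pr p_odd; rewrite -card_nonzero_Fp //.
rewrite (@card_opp_closed _ [set x | x != 0%R]) // => [||x];
  rewrite ?inE ?eqxx ?oppr_eq0 //.
congr (2 * _); set H := [set x in _ | _].
rewrite -(card_in_imset (f := fun y : 'F_p => (y ^+ 2)%R) (D := H)); last first.
  move=> x y; rewrite !inE => /andP[nz_x lt2x] /andP[nz_y lt2y] /eqP.
  rewrite eqf_sqr => /orP[/eqP // | /eqP x_opp_y].
  move: lt2x; rewrite x_opp_y Fp_opp_nat //.
  by have := Fp_lt p y p_pr; lia.
apply: eq_card => x; rewrite [RHS]inE; apply/imsetP/andP.
  case=> y; rewrite !inE => /andP[nz_y _] ->; rewrite expf_eq0 /=; split=> //.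
  by apply/existsP; exists y.
case=> nz_x /existsP[y /eqP def_x].
have nz_y : y != 0%R by move: nz_x; rewrite def_x expf_eq0.
case: (ltnP (2 * y) p) => [lt2y | le2y]; first by exists y; rewrite ?inE ?nz_y.
exists (- y)%R; last by rewrite sqrrN.
by rewrite !inE oppr_eq0 nz_y Fp_opp_nat //; have := Fp_lt p y p_pr; lia.
Qed.

(** With [p = 4 * k + 1], the equation [y ^+ (2 * k) = 1] has at most [2 * k] roots, so it fails for
    some nonzero [y]. By Fermat this power squares to 1, hence it is -1, and [y ^+ k] is the
    required root. *)
Lemma Fp_opp1_square (p : nat) :
  prime p -> p = 1 %[mod 4] -> exists y : 'F_p, (y ^+ 2 = -1)%R.
Proof.
move=> p_pr p1; pose k := p %/ 4.
have def_p : p = (4 * k).+1 by rewrite {1}(divn_eq p 4) p1 mulnC addn1.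
have k_gt0 : 0 < k by have := prime_gt1 p_pr; lia.
have [y nz_y ny] : exists2 y : 'F_p, y != 0%R & (y ^+ (2 * k) != 1)%R.
  apply/exists_inP; apply: contraT => /exists_inPn all1.
  have := @max_unity_roots 'F_p (2 * k) (enum [set x : 'F_p | x != 0%R]).
  rewrite enum_uniq -cardE card_nonzero_Fp // => /(_ _ _ isT) bound.
  suff : p.-1 <= 2 * k by lia.
  apply: bound; first by lia.
  apply/allP => y; rewrite mem_enum inE => nz_y; rewrite unity_rootE.
  by have := all1 y nz_y; rewrite negbK.
exists (y ^+ k)%R; rewrite -exprM mulnC; apply/eqP.
have : ((y ^+ (2 * k)) ^+ 2 == 1 ^+ 2)%R.
  rewrite expr1n -exprM; apply/eqP; apply: (mulfI nz_y).
  rewrite mulr1 -exprS (_ : _.+1 = #|'F_p|) ?expf_card // card_Fp //.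
  by rewrite def_p; lia.
by rewrite eqf_sqr (negPf ny).
Qed.

Lemma card_small_squares (p : nat) : prime p -> p = 1 %[mod 4] ->
  p.-1 = 4 * #|[set s in nz_squares p | 2 * (s : nat) < p]|.
Proof.
move=> p_pr p1; have p_odd : odd p by rewrite (divn_eq p 4) p1; lia.
rewrite card_nz_squares // card_opp_closed ?inE ?eqxx //; first by lia.
have [i i2] := Fp_opp1_square p p_pr p1.
move=> x; rewrite !inE oppr_eq0 => /andP[-> /existsP[y /eqP ->]].
by apply/existsP; exists (i * y)%R; rewrite exprMn i2 mulN1r.
Qed.

(** * The combinatorial obstruction to an alpha-valuation *)

(* When f r > 1 the edges of differences n and n - 1 avoid the root and meet,
   since both join {0, 1} to {n - 1, n}; when f r <= 1 and x > 2 the same holds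
   for the edges of differences 1 and 2, between {x - 1, x} and
   {x + 1, x + 2}. *)
Lemma spider_no_separated_labelling (V : eqType) (e : rel V) (r : V) (A : pred V)
    (f : V -> nat) (n x : nat) :
  injective f -> 0 < n ->
  (forall u, f u <= n) -> (forall u, A u -> f u <= x) ->
  (forall u, ~~ A u -> x < f u) ->
  (forall u u' v, A u -> A u' -> u != r -> u' != r -> e u v -> e u' v -> u = u') ->
  (forall u v v', A u -> u != r -> e u v -> e u v' -> v = v') ->
  (forall d, 0 < d <= n ->
     exists u v, [/\ A u, ~~ A v, e u v & f v = f u + d]) ->
  x <= 2.
Proof.
move=> f_inj n_gt0 f_le A_le A_gt twin leaf diffs.
rewrite leqNgt; apply/negP => x_gt2.
have x_lt : x < n.
  have [|_ [v [_ Bv _ _]]] := diffs n; first by rewrite n_gt0 leqnn.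
  exact: leq_trans (A_gt v Bv) (f_le v).
have ne_r u : f u != f r -> u != r by apply: contraNneq => ->.
(* Two edges that leave [A] away from the root and share an end carry the same labels. Two edges
   with different differences therefore contradict this as soon as they are shown to meet. *)
have e_uniq u v u' v' : A u -> A u' -> f u != f r -> f u' != f r ->
    f v = f v' \/ f u = f u' -> e u v -> e u' v' -> f u = f u' /\ f v = f v'.
  move=> Au Au' /ne_r ur /ne_r u'r [/f_inj eqv | /f_inj equ] euv eu'v'.
    by rewrite -eqv in eu'v' *; rewrite (twin u u' v).
  by rewrite -equ in eu'v' *; rewrite (leaf u v v').
have n_gt3 : 3 < n by apply: leq_ltn_trans x_lt.
have [r_le1 | r_gt1] := leqP (f r) 1.
  have [|u [v [Au Bv euv duv]]] := diffs 1; first by rewrite (ltn_trans _ n_gt3).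
  have [|u' [v' [Au' Bv' euv' duv']]] := diffs 2.
    by rewrite (leq_trans _ n_gt3).
  have := (A_le u Au, A_le u' Au', A_gt v Bv, A_gt v' Bv').
  move=> [[[le_u le_u'] gt_v] gt_v'].
  (* Difference 1 forces the labels [x | x + 1], and difference 2 forces [x - 1 | x + 1] or
     [x | x + 2]: the edges meet. Their ends in [A] are labelled at least [x - 1 > 1], so neither is
     the root. *)
  have [|||//|//|] := e_uniq u v u' v' Au Au';
    by clear -le_u le_u' gt_v gt_v' duv duv' r_le1 x_gt2; lia.
have [|u [v [Au Bv euv duv]]] := diffs n; first by rewrite leqnn andbT (ltn_trans _ n_gt3).
have [|u' [v' [Au' Bv' euv' duv']]] := diffs n.-1; first by clear -n_gt3; lia.
have := (f_le u, f_le u', f_le v, f_le v').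
move=> [[[le_u le_u'] le_v] le_v'].
(* Difference [n] forces [0 | n], and difference [n - 1] forces [0 | n - 1] or [1 | n]. The ends in
   [A] are labelled at most 1, so neither is the root. *)
have [|||//|//|] := e_uniq u v u' v' Au Au';
  by clear -le_u le_u' le_v le_v' duv duv' r_gt1 n_gt3; lia.
Qed.

(** * Levels, labels and parents in T *)

Lemma T_level_cases (p : nat) (v : T p) :
  [\/ T_level v = 0 /\ (val v).2 = 0%R,
      T_level v = 1 /\ ((val v).2 \in nonsquares p \/
        (val v).2 \in nz_squares p /\ p < 2 * T_label v)
    | T_level v = 2 /\ (val v).2 \in nz_squares p /\ 2 * T_label v < p].
Proof.
rewrite /T_label /T_level; case: v => -[[[|[|[|//]]] l3] x] /=;
  rewrite /level_labels /= !inE.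
- by move=> /eqP; constructor 1.
- by move=> x1; constructor 2; split=> //; case/orP: x1 => [|/andP[]]; [left | right].
- by move=> /andP[]; constructor 3.
Qed.

Lemma nz_square_notin_nonsquares (p : nat) (x : 'F_p) :
  x \in nz_squares p -> x \notin nonsquares p.
Proof. by rewrite !inE negbK => /andP[]. Qed.

Lemma nonsquare_neq0 (p : nat) (x : 'F_p) : x \in nonsquares p -> x != 0%R.
Proof.
rewrite inE; apply: contraNneq => ->; apply/existsP; exists 0%R.
by rewrite expr0n.
Qed.

(** The label sets of the three levels are pairwise disjoint, so a label determines its level. *)
Lemma T_label_inj (p : nat) : injective (@T_label p).
Proof.
move=> u v eq_uv; have {}eq_uv : (val u).2 = (val v).2 by apply: val_inj.
apply: val_inj; move: (T_level_cases _ u) (T_level_cases _ v).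
rewrite /T_level /T_label -eq_uv; move: eq_uv.
case: (val u) => l x; case: (val v) => l' y /= <-.
have N0 := @nonsquare_neq0 p x; have NS := @nz_square_notin_nonsquares p x.
have S0 : x \in nz_squares p -> x != 0%R by rewrite inE => /andP[].
move=> cu cv; congr (_, _); apply: val_inj => /=; move: cu cv.
case=> [[-> /eqP x0] | [-> [xN | [xS lt]]] | [-> [xS lt]]];
  case=> [[-> /eqP x0'] | [-> [xN' | [xS' lt']]] | [-> [xS' lt']]] //;
  move: N0 NS S0; rewrite ?x0 ?x0' ?xN ?xN' ?xS ?xS' => N0 NS S0;
  by first [by move: (N0 isT) | by move: (NS isT) | by move: (S0 isT) | lia].
Qed.

Lemma T_label_lt (p : nat) (v : T p) : prime p -> T_label v < p.
Proof. exact: Fp_lt. Qed.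

Lemma T_vertex_with_label (p : nat) (x : 'F_p) :
  prime p -> odd p -> exists v : T p, (val v).2 = x.
Proof.
move=> p_pr p_odd.
have vert (l : 'I_3) : x \in level_labels p l -> exists v : T p, (val v).2 = x.
  by move=> xl; exists (exist _ (l, x) xl).
have [x0 | nz_x] := eqVneq x 0%R; first by apply: (vert ord0); rewrite inE x0.
case: (boolP (x \in nonsquares p)) => [xN | xN].
  by apply: (vert (inord 1)); rewrite /level_labels /= inordK // inE xN.
have xS : x \in nz_squares p by move: xN; rewrite !inE negbK nz_x.
case: (ltngtP (2 * x) p) => [lt2x | gt2x | eq2x].
- by apply: (vert (inord 2)); rewrite /level_labels /= inordK // inE xS.
- by apply: (vert (inord 1)); rewrite /level_labels /= inordK // !(xS, inE) gt2x orbT.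
- by clear -p_odd eq2x; lia.
Qed.

Lemma T_parent_level (p : nat) (u v : T p) :
  T_parent u v -> T_level v = (T_level u).+1.
Proof. by case/orP => [/andP[/eqP -> /eqP ->]|/and3P[/eqP -> /eqP ->]]. Qed.

Lemma T_root_label (p : nat) : T_label (T_root p) = 0.
Proof. by []. Qed.

Lemma T_level0 (p : nat) (v : T p) : T_level v = 0 -> v = T_root p.
Proof.
move=> v0; apply: T_label_inj; rewrite T_root_label.
by case: (T_level_cases _ v) => -[]; rewrite v0 // => _; rewrite /T_label => ->.
Qed.

Lemma T_parent_uniq (p : nat) (u v w : T p) : T_parent u w -> T_parent v w -> u = v.
Proof.
case/orP => [/andP[/eqP u0 /eqP w1]|/and3P[/eqP u1 /eqP w2 /eqP lu]];
case/orP => [/andP[/eqP v0 /eqP w1']|/and3P[/eqP v1 /eqP w2' /eqP lv]].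
- by rewrite (T_level0 _ _ u0) (T_level0 _ _ v0).
- by rewrite w1 in w2'.
- by rewrite w2 in w1'.
- by apply: T_label_inj; rewrite lu lv.
Qed.

Lemma T_child_uniq (p : nat) (u v w : T p) :
  T_level u = 1 -> T_parent u v -> T_parent u w -> v = w.
Proof.
rewrite /T_parent => -> /= /andP[_ /eqP lv] /andP[_ /eqP lw].
by apply: T_label_inj; lia.
Qed.

(** If [s] is [z ^+ 2] and its double is [y ^+ 2], then [y / z] is a square root of 2. *)
Lemma double_small_square (p : nat) (s : 'F_p) :
  prime p -> p != 1 %[mod 8] -> p != 7 %[mod 8] -> 2 < p ->
  s \in nz_squares p -> (s *+ 2)%R \in nonsquares p.
Proof.
move=> p_pr p_n1 p_n7 p_gt2; rewrite !inE => /andP[nz_s /existsP[z /eqP def_s]].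
apply/existsP => -[y /eqP def_2s].
have nz_z : (z ^+ 2 != 0)%R by rewrite -def_s.
have /negP[] := Fp_two_nonsquare p (y / z)%R p_pr p_n1 p_n7 p_gt2.
by rewrite expr_div_n -def_2s def_s -(mulr_natl (z ^+ 2)%R) mulfK.
Qed.

(** At level 2 the doubled label stays below [p] and is a nonsquare, hence it labels a vertex of
    level 1. *)
Lemma T_parent_exists (p : nat) (w : T p) :
  prime p -> p != 1 %[mod 8] -> p != 7 %[mod 8] -> 2 < p ->
  T_level w != 0 -> exists u, T_parent u w.
Proof.
move=> p_pr p_n1 p_n7 p_gt2; case: (T_level_cases _ w) => -[lw]; rewrite lw // => xw _.
  by exists (T_root p); rewrite /T_parent lw.
have [xS lt2x] := xw; pose x := ((val w).2 *+ 2)%R.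
have xN : x \in nonsquares p by apply: double_small_square.
have x1 : x \in level_labels p (inord 1).
  by rewrite /level_labels /= inordK // inE xN.
pose u : T p := exist _ (inord 1, x) x1.
have u1 : T_level u = 1 by rewrite /T_level /= inordK.
have lu : T_label u = 2 * T_label w by apply: Fp_double_nat.
by exists u; rewrite /T_parent u1 lw lu !eqxx.
Qed.

(** * T is a tree *)

Lemma T_connect_root (p : nat) (v : T p) :
  prime p -> p != 1 %[mod 8] -> p != 7 %[mod 8] -> 2 < p ->
  connect adj (T_root p) v.
Proof.
move=> p_pr p_n1 p_n7 p_gt2; have [n] := ubnP (T_level v).
elim: n v => // n IHn v lt_vn.
have [/T_level0 -> // | v_gt0] := eqVneq (T_level v) 0.
have [u uv] := T_parent_exists p v p_pr p_n1 p_n7 p_gt2 v_gt0.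
apply: connect_trans (IHn u _) _; first by rewrite -(T_parent_level _ _ _ uv).
by apply: connect1; rewrite /= /T_adj uv.
Qed.

(* Both cyclic neighbours of a vertex of maximal level would be its parent. *)
Lemma T_acyclic (p : nat) (c : seq (T p)) : 2 < size c -> ~ ucycle (@adj (T p)) c.
Proof.
case: c => // x0 c0; set c := x0 :: c0 => size_c cyc.
have [x xc x_max] : exists2 x, x \in c & forall y, y \in c -> T_level y <= T_level x.
  have x0c : x0 \in c by rewrite mem_head.
  by case: (arg_maxnP (fun y : T p => T_level y) x0c) => x; exists x.
have [i s def_s] := rot_to xc.
have size_s : 2 < size (x :: s) by rewrite -def_s size_rot.
have {}x_max y : y \in x :: s -> T_level y <= T_level x.
  by rewrite -def_s mem_rot; apply: x_max.
have : ucycle (@adj (T p)) (x :: s) by rewrite -def_s rot_ucycle.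
move=> /andP[] {def_s size_c}.
have parentP y : y \in x :: s -> T_adj y x -> T_parent y x.
  by move=> /x_max le_yx /orP[// | /T_parent_level]; lia.
(* Here [z] precedes [x] on the cycle and [y] follows it; they are separate entries because the
   cycle has length greater than 2. *)
case/lastP: s => // s z in size_s x_max parentP *.
case: s => // y s in size_s x_max parentP *.
rewrite /= rcons_path last_rcons => /andP[xy /andP[_ zx]].
move=> /and3P[_ yz _].
suff yz_eq : y = z by rewrite yz_eq mem_rcons mem_head in yz.
have yxs : y \in x :: y :: rcons s z by rewrite !inE eqxx orbT.
have zxs : z \in x :: y :: rcons s z by rewrite !inE mem_rcons mem_head !orbT.
by apply: T_parent_uniq (parentP y yxs _) (parentP z zxs zx); rewrite T_adj_sym.
Qed.

Lemma T_is_tree (p : nat) :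
  prime p -> p != 1 %[mod 8] -> p != 7 %[mod 8] -> 2 < p -> is_tree (T p).
Proof.
move=> p_pr p_n1 p_n7 p_gt2; split; last exact: T_acyclic.
  by apply/card_gt0P; exists (T_root p).
move=> u v; have root_to w := T_connect_root p w p_pr p_n1 p_n7 p_gt2.
by apply: connect_trans (root_to v); rewrite (sym_connect_sym (@adj_sym (T p))) root_to //.
Qed.

(** * The labels form a near alpha-valuation *)

Lemma T_label_gt0 (p : nat) (v : T p) : T_level v != 0 -> 0 < T_label v.
Proof.
rewrite lt0n; apply: contra => /eqP v0.
by rewrite (T_label_inj _ v (T_root p)).
Qed.

Lemma T_parent_label (p : nat) (u v : T p) : T_parent u v ->
  0 < T_label v /\
  (T_level u = 0 /\ T_label u = 0 \/ T_level u = 1 /\ T_label u = 2 * T_label v).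
Proof.
move=> uv; split; first by apply: T_label_gt0; rewrite (T_parent_level _ _ _ uv).
case/orP: uv => [/andP[/eqP u0 _]|/and3P[/eqP u1 _ /eqP]]; last by right.
by left; rewrite (T_level0 _ _ u0).
Qed.

(** The parent of a vertex labelled [s] is labelled 0 or [2 * s], both at distance [s] from [s]. *)
Lemma T_parent_diff (p : nat) (u v : T p) : T_parent u v ->
  edge_diff (G := T p) (@T_label p) [set u; v] = T_label v.
Proof.
move=> /T_parent_label[_ lu]; rewrite (edge_diffE (G := T p)).
by move: lu; clear; lia.
Qed.

Lemma T_edgesP (p : nat) (e : {set T p}) :
  reflect (exists u v, T_parent u v /\ e = [set u; v]) (e \in edges (T p)).
Proof.
apply: (iffP imsetP) => [[[u v]] | [u [v [uv ->]]]].
  rewrite inE => /orP[] /= uv ->; first by exists u, v.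
  by exists v, u; rewrite setUC.
by exists (u, v) => //; rewrite inE /= /T_adj uv.
Qed.

(** Edges correspond to non-root vertices through the lower end, and the labels of these vertices
    are [1, ..., p - 1], each once. *)
Lemma T_edge_diffs (p : nat) :
  prime p -> p != 1 %[mod 8] -> p != 7 %[mod 8] -> 2 < p ->
  perm_eq [seq edge_diff (G := T p) (@T_label p) e | e in edges (T p)] (iota 1 p.-1).
Proof.
move=> p_pr p_n1 p_n7 p_gt2.
have p_odd : odd p by have /even_prime[p2|] := p_pr; first by rewrite p2 in p_gt2.
apply: uniq_perm; rewrite ?iota_uniq //.
  apply/dinjectiveP => e e' /T_edgesP[u [v [uv ->]]] /T_edgesP[u' [v' [uv' ->]]].
  rewrite !T_parent_diff // => /T_label_inj eq_v.
  by rewrite -eq_v in uv' *; rewrite (T_parent_uniq _ _ _ _ uv uv').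
move=> d; rewrite mem_iota; apply/imageP/idP => [[e /T_edgesP[u [v [uv ->]]] ->] | d_in].
  rewrite T_parent_diff //; have lt_vp := T_label_lt _ v p_pr.
  have [v_gt0 _] := T_parent_label _ _ _ uv.
  by rewrite v_gt0 add1n prednK // prime_gt0.
have [v def_v] := T_vertex_with_label p (d%:R)%R p_pr p_odd.
have lv : T_label v = d.
  rewrite /T_label def_v val_Fp_nat // modn_small //.
  by clear -d_in p_gt2; lia.
have [|u uv] := T_parent_exists p v p_pr p_n1 p_n7 p_gt2.
  by apply/eqP => /T_level0 v0; move: d_in; rewrite -lv v0.
exists [set u; v]; last by rewrite T_parent_diff.
by apply/T_edgesP; exists u, v.
Qed.

Lemma T_card_edges (p : nat) :
  prime p -> p != 1 %[mod 8] -> p != 7 %[mod 8] -> 2 < p -> #|edges (T p)| = p.-1.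
Proof.
move=> p_pr p_n1 p_n7 p_gt2.
by have /perm_size := T_edge_diffs p p_pr p_n1 p_n7 p_gt2; rewrite size_image size_iota.
Qed.

(** Level 1 is the large class: its labels exceed the root's label 0 and are twice those of their
    children. *)
Lemma T_near_alpha (p : nat) :
  prime p -> p != 1 %[mod 8] -> p != 7 %[mod 8] -> 2 < p ->
  near_alpha_valuation (G := T p) (@T_label p).
Proof.
move=> p_pr p_n1 p_n7 p_gt2; split.
  split; rewrite ?T_card_edges ?T_edge_diffs //; first exact: T_label_inj.
  by move=> v; rewrite -ltnS prednK ?prime_gt0 ?T_label_lt.
pose L := [set v : T p | T_level v == 1]; exists (~: L), L; split.
- by rewrite setUC setUCr.
- by rewrite disjoints_subset.
- move=> v u; rewrite !inE => v1 /orP[] vu; have := T_parent_label _ _ _ vu.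
    by move: v1; clear; lia.
  by move: v1; rewrite (T_parent_level _ _ _ vu); clear; lia.
move=> v u; rewrite !inE => v1 /orP[] vu; have := T_parent_label _ _ _ vu.
  by move: v1; clear; lia.
by move: v1; rewrite (T_parent_level _ _ _ vu); clear; lia.
Qed.

(** * T has no alpha-valuation *)

Lemma T_level2_vertex (p k m : nat) : prime p -> 0 < k -> 2 * k < p ->
  k = m ^ 2 %[mod p] -> exists2 v : T p, T_level v = 2 & T_label v = k.
Proof.
move=> p_pr k_gt0 lt2k def_k; pose x : 'F_p := (k%:R)%R.
have x_nat : (x : nat) = k.
  by rewrite val_Fp_nat // modn_small //; clear -lt2k; lia.
have xS : x \in level_labels p (inord 2).
  rewrite /level_labels /= inordK // !inE x_nat lt2k andbT; apply/andP; split.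
    by apply/eqP => x0; move: k_gt0; rewrite -x_nat x0.
  apply/existsP; exists (m%:R)%R; apply/eqP/val_inj.
  by rewrite -natrX /= !val_Fp_nat.
by exists (exist _ (inord 2, x) xS); rewrite // /T_level /= inordK.
Qed.

(* The squares 1, 4 and 9 (or 16 mod p, when p < 19) are below p / 2. *)
Lemma T_four_vertices (p : nat) :
  prime p -> 11 <= p -> p != 1 %[mod 8] ->
  exists s : seq (T p), [/\ uniq s, size s = 4 & forall v, v \in s -> T_level v != 1].
Proof.
move=> p_pr p_ge p_n1.
have [k [m [k_gt0 k14 lt2k def_k]]] :
    exists k m, [/\ 0 < k, k \notin [:: 1; 4], 2 * k < p & k = m ^ 2 %[mod p]].
  case: (ltnP p 19) => [p_lt | p_ge19]; last by exists 9, 3.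
  (* The prime 17 is excluded, being 1 modulo 8; 16 is 5 modulo 11 and 3 modulo 13. *)
  suff [-> | ->] : p = 11 \/ p = 13 by [exists 5, 4 | exists 3, 4].
  move: p_pr p_ge p_n1 p_lt; clear.
  by do 19 (case: p => [|p]; [by first [done | by left | by right] | ]).
have [|||v1 l1 d1] := @T_level2_vertex p 1 1 p_pr => //; first exact: leq_trans p_ge.
have [|||v4 l4 d4] := @T_level2_vertex p 4 2 p_pr => //; first exact: leq_trans p_ge.
have [|||vk lk dk] := @T_level2_vertex p k m p_pr => //.
exists [:: T_root p; v1; v4; vk]; split=> //.
  rewrite -(map_inj_uniq (@T_label_inj p)) /= d1 d4 dk T_root_label !inE in k14 *.
  by clear -k_gt0 k14; lia.
by move=> v; rewrite !inE => /or4P[] /eqP ->; rewrite ?l1 ?l4 ?lk.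
Qed.

(** Such a vertex has level 2 and is a leaf. This gives the disjointness of edges required by
    [spider_no_separated_labelling]. *)
Lemma T_adj_even_level (p : nat) (u v : T p) :
  T_level u != 1 -> u != T_root p -> T_adj u v -> T_parent v u /\ T_level v = 1.
Proof.
move=> u1 ur uv; have u0 : T_level u != 0 by apply: contraNneq ur => /T_level0 ->.
have lu : T_level u = 2 by move: u0 u1; case: (T_level_cases _ u) => -[->].
case/orP: uv => /[dup] /T_parent_level; rewrite lu; last by case=> <-.
by case: (T_level_cases _ v) => -[->].
Qed.

Lemma T_no_alpha (p : nat) (b : T p -> nat) :
  prime p -> 11 <= p -> p != 1 %[mod 8] -> p != 7 %[mod 8] -> ~ alpha_valuation b.
Proof.
move=> p_pr p_ge p_n1 p_n7 [[b_inj b_le b_diffs] [x x_le b_sep]].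
have p_gt2 : 2 < p by apply: leq_trans p_ge.
have parent w := T_parent_exists p w p_pr p_n1 p_n7 p_gt2.
move: b_le b_diffs x_le; set n := #|edges _| => b_le b_diffs x_le.
have n_gt0 : 0 < n by rewrite /n T_card_edges // -subn1 subn_gt0 ltnW.
have [s [s_uniq s_size s_lev]] := T_four_vertices p p_pr p_ge p_n1.
have diffs d : 0 < d <= n ->
    exists u v, [/\ T_level u != 1, ~~ (T_level v != 1), T_adj u v & `|b u - b v|%N = d].
  move=> d_in; have : d \in iota 1 n by rewrite mem_iota add1n ltnS.
  rewrite -(perm_mem b_diffs) => /imageP[e /T_edgesP[u [v [uv ->]]] ->].
  rewrite edge_diffE; case/orP: (uv) => [/andP[/eqP u0 /eqP v1]|/and3P[/eqP u1 /eqP v2 _]].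
    by exists u, v; rewrite u0 v1 /T_adj uv.
  by exists v, u; rewrite u1 v2 /T_adj uv orbT distnC.
(* This is applied to [f = b] or to its complement [n - b], whichever puts the even levels on the
   low side of the threshold [y]. *)
have half (f : T p -> nat) y : injective f -> (forall u, f u <= n) ->
    (forall u, T_level u != 1 -> f u <= y) -> (forall u, ~~ (T_level u != 1) -> y < f u) ->
    (forall u v, f u <= f v -> `|b u - b v|%N = f v - f u) -> False.
  move=> f_inj f_le A_le A_gt f_diff.
  have y_gt2 : 2 < y.
    have : size (map f s) <= size (iota 0 y.+1).
      apply: uniq_leq_size; first by rewrite map_inj_uniq.
      by move=> _ /mapP[v /s_lev/A_le le_v ->]; rewrite mem_iota ltnS.
    by rewrite size_map size_iota s_size.
  suff : y <= 2 by rewrite leqNgt y_gt2.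
  apply: (spider_no_separated_labelling _ (@T_adj p) (T_root p)
            (fun u => T_level u != 1) f n y) => //.
  - move=> u u' v Au Au' ur u'r /(T_adj_even_level _ _ _ Au ur)[vu v1].
    by move=> /(T_adj_even_level _ _ _ Au' u'r)[vu' _]; apply: T_child_uniq v1 vu vu'.
  - move=> u v v' Au ur /(T_adj_even_level _ _ _ Au ur)[vu _].
    by move=> /(T_adj_even_level _ _ _ Au ur)[vu' _]; apply: T_parent_uniq vu vu'.
  move=> d /diffs[u [v [Au Bv uv duv]]]; exists u, v; split=> //.
  have lt_uv : f u < f v := leq_ltn_trans (A_le u Au) (A_gt v Bv).
  by rewrite -duv f_diff ?(ltnW lt_uv) // subnKC // ltnW.
have sep u v : T_adj u v -> (b u <= x) = ~~ (b v <= x).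
  by move=> /b_sep; clear; lia.
have side1 v : T_level v = 1 -> (b v <= x) = ~~ (b (T_root p) <= x).
  by move=> v1; apply: sep; rewrite /T_adj /T_parent v1 orbT.
(* Every edge crosses the threshold, so a vertex at even distance from the root lies on the root's
   side. *)
have side u : T_level u != 1 -> (b u <= x) = (b (T_root p) <= x).
  case: (T_level_cases _ u) => -[lu _]; rewrite lu // => _; first by rewrite (T_level0 _ _ lu).
  have [|v vu] := parent u; first by rewrite lu.
  have [v1] : 2 = (T_level v).+1 by rewrite -(T_parent_level _ _ _ vu).
  by rewrite (sep u v) ?(side1 v) ?negbK // /T_adj vu orbT.
case: (boolP (b (T_root p) <= x)) side side1 => root_x side side1.
  apply: (half b x) => //.
    by move=> u /negPn/eqP u1; rewrite ltnNge side1.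
  by move=> u v; clear; lia.
(* The root is above [x], so [x < n] and the condition [x < b u] becomes [n - b u <= n - x.+1] after
   complementation. *)
apply: (half (fun u => n - b u) (n - x.+1)) => //.
- move=> u v eq_uv; apply: b_inj; have := (b_le u, b_le v) => -[].
  by move: eq_uv; clear; lia.
- by move=> u; rewrite leq_subr.
- by move=> u u1; have := side u u1; clear; lia.
- move=> u /negPn/eqP u1; have := side1 u u1; have := b_le (T_root p).
  by move: root_x; clear; lia.
by move=> u v; have := (b_le u, b_le v) => -[]; clear; lia.
Qed.

(** * Counting children *)

Lemma T_kids_root (p : nat) :
  children (T_root p) (T_root p) = [set w : T p | T_level w == 1].
Proof.
apply/setP => w; rewrite !inE; apply/andP/eqP => [[rw _] | w1].
  by case/orP: rw => /T_parent_level.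
split; first by rewrite /= /T_adj /T_parent w1.
apply/negP => /connectP[[|y s]]; first by move=> _ wr; rewrite wr in w1.
by case/andP=> /and3P[_ /eqP].
Qed.

Lemma T_kids_level1 (p : nat) (c : T p) : T_level c = 1 ->
  children (T_root p) c = [set w | T_parent c w].
Proof.
move=> c1; apply/setP => w; rewrite !inE; apply/andP/idP => [[/orP[//|wc]] | cw].
  (* The other neighbour of [c] is the root, which the empty path reaches while avoiding [c]. *)
  rewrite (T_level0 _ w) ?connect0 //.
  by have := T_parent_level _ _ _ wc; rewrite c1 => -[].
have w2 := T_parent_level _ _ _ cw; rewrite c1 in w2.
split; first by rewrite /= /T_adj cw.
apply/negP => /connectP[s]; case/lastP: s => [|s z] /=.
  by move=> _ wr; rewrite wr in w2.
(* The last edge of a path avoiding [c] would enter the leaf [w] from a neighbour other than [c]. *)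
rewrite rcons_path last_rcons => /andP[_ /and3P[+ + _]] wz; rewrite -wz.
case/orP=> [yw | /T_parent_level].
  by rewrite (T_parent_uniq _ _ _ _ yw cw) eqxx.
by rewrite w2; case: (T_level_cases _ (last (T_root p) s)) => -[->].
Qed.

Lemma T_card_kids (p : nat) (c : T p) : T_level c = 1 ->
  #|children (T_root p) c| = [exists w, T_parent c w].
Proof.
move=> c1; rewrite T_kids_level1 //; case: existsP => [[w cw] | no_w]; last first.
  by apply: eq_card0 => w; rewrite inE; apply/negP => cw; case: no_w; exists w.
apply/eqP/cards1P; exists w; apply/setP => w'; rewrite !inE; apply/idP/eqP => [cw' | -> //].
exact: T_child_uniq c1 cw' cw.
Qed.

Lemma T_card (p : nat) : prime p -> odd p -> #|T p| = p.
Proof.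
move=> p_pr p_odd; rewrite -[RHS](card_Fp p_pr) -cardsT.
rewrite -(card_imset _ (f := fun v : T p => (val v).2)).
  apply: eq_card => x; have [v <-] := T_vertex_with_label p x p_pr p_odd.
  by rewrite [RHS]inE; apply/imsetP; exists v.
by move=> u v eq_uv; apply: T_label_inj; rewrite /T_label eq_uv.
Qed.

Lemma T_card_level2 (p : nat) :
  #|[set v : T p | T_level v == 2]| = #|[set s in nz_squares p | 2 * (s : nat) < p]|.
Proof.
rewrite -(card_imset _ (f := fun v : T p => (val v).2)); last first.
  by move=> u v eq_uv; apply: T_label_inj; rewrite /T_label eq_uv.
apply: eq_card => x; rewrite [RHS]inE; apply/imsetP/andP => [[v] | [xS lt2x]].
  by rewrite inE => v2 ->; case: (T_level_cases _ v) v2 => -[-> []].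
have x2 : x \in level_labels p (inord 2) by rewrite /level_labels /= inordK // inE xS.
by exists (exist _ (inord 2, x) x2); rewrite // inE /T_level /= inordK.
Qed.

Lemma T_card_level1 (p : nat) : prime p -> odd p ->
  #|[set v : T p | T_level v == 1]| + #|[set v : T p | T_level v == 2]| = p.-1.
Proof.
move=> p_pr p_odd; have := cardsC1 (T_root p); rewrite T_card // => <-.
rewrite -cardsUI (_ : _ :&: _ = set0) ?cards0 ?addn0.
  apply: eq_card => v; rewrite !inE; have [-> //|] := eqVneq v (T_root p).
  case: (T_level_cases _ v) => -[lv _]; rewrite lv //=.
  by rewrite (T_level0 _ _ lv) eqxx.
by apply/setP => v; rewrite !inE; apply/negP => /andP[/eqP ->].
Qed.

(** The parent map is injective on level 2, since a level-1 vertex has at most one child, and its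
    image is the set of level-1 vertices with a child. The default [T_root p] in [par] is never
    reached on level 2. *)
Lemma T_card_parents (p : nat) :
  prime p -> p != 1 %[mod 8] -> p != 7 %[mod 8] -> 2 < p ->
  #|[set c : T p | (T_level c == 1) && [exists w, T_parent c w]]| =
  #|[set v : T p | T_level v == 2]|.
Proof.
move=> p_pr p_n1 p_n7 p_gt2; pose par (w : T p) := odflt (T_root p) [pick u | T_parent u w].
have parP w : T_level w = 2 -> T_parent (par w) w.
  move=> w2; rewrite /par; case: pickP => //= no_par.
  by have [|u] := T_parent_exists p w p_pr p_n1 p_n7 p_gt2; rewrite ?w2 ?no_par.
have par1 w : T_level w = 2 -> T_level (par w) = 1.
  by move=> w2; have := T_parent_level _ _ _ (parP w w2); rewrite w2 => -[].
rewrite -(card_in_imset (f := par) (D := [set v | T_level v == 2])); last first.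
  move=> v w; rewrite !inE => /eqP v2 /eqP w2 eq_vw.
  by apply: T_child_uniq (par1 v v2) (parP v v2) _; rewrite eq_vw; apply: parP.
apply: eq_card => c; rewrite inE; apply/andP/imsetP => [[/eqP c1 /existsP[w cw]] | [w]].
  have w2 : T_level w = 2 by rewrite (T_parent_level _ _ _ cw) c1.
  by exists w; rewrite ?inE ?w2 // (T_parent_uniq _ _ _ _ cw (parP w w2)).
rewrite inE => /eqP w2 ->; rewrite par1 //; split=> //.
by apply/existsP; exists w; apply: parP.
Qed.

Theorem theorem3p11 (p : nat) :
  prime p -> 11 <= p -> p != 1 %[mod 8] -> p != 7 %[mod 8] ->
  [/\ forall s : 'F_p, s \in nz_squares p -> 2 * (s : nat) < p ->
        (s *+ 2)%R \in nonsquares p,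
      is_tree (T p),
      near_alpha_valuation (G := T p) (@T_label p),
      ~ (exists b : T p -> nat, alpha_valuation b)
    & p = 5 %[mod 8] ->
      let kids := @children (T p) in
      let r := T_root p in
      [/\ #|kids r r| = 3 * (p - 1) %/ 4,
          #|[set c in kids r r | #|kids r c| == 1]| = (p - 1) %/ 4
        & forall c : T p, c \in kids r r -> #|kids r c| != 1 ->
            #|kids r c| = 0]].
Proof.
move=> p_pr p_ge p_n1 p_n7; have p_gt2 : 2 < p by apply: leq_trans p_ge.
split.
- by move=> s sS _; apply: double_small_square.
- exact: T_is_tree.
- exact: T_near_alpha.
- by case=> b; apply: T_no_alpha.
move=> p5 kids r.
have p_odd : odd p by have /even_prime[p2|] := p_pr; first by rewrite p2 in p_gt2.
have p1 : p = 1 %[mod 4] by clear -p5; lia.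
(* Level 2 has [(p - 1) / 4] vertices, which leaves [3 * (p - 1) / 4] of the [p - 1] non-root
   vertices for level 1. *)
have card2 := card_small_squares p p_pr p1; rewrite -T_card_level2 in card2.
have card1 := T_card_level1 p p_pr p_odd.
rewrite /kids /r T_kids_root; split.
- by move: card1 card2; clear; lia.
- rewrite -T_card_parents // in card2; rewrite subn1 card2 mulKn //.
  apply: eq_card => c; rewrite !inE; case: eqP => //= c1.
  by rewrite T_card_kids //; case: [exists w, _].
move=> c; rewrite inE => /eqP c1; rewrite T_card_kids //.
by case: [exists w, _].
Qed.
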